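(* Let $\mathfrak g$ be a $7$-dimensional $2$-step nilpotent real Lie algebra with a basis $\{e_1,\dots,e_7\}$ whose dual basis satisfies $$de^i=0\ (i=1,\dots,6),\qquad de^7=a\,e^{12}+b\,e^{34}+c\,e^{56},$$ with $a,b,c\in\mathbb R$ not all zero, and with the $\mathrm G_2$-structure $$\varphi=e^{127}+e^{347}+e^{567}+e^{135}-e^{146}-e^{236}-e^{245}.$$ Let $\lambda\in\mathbb R$. The connection $\nabla^\lambda$ is a $\mathrm G_2$-instanton if and only if $\lambda=1$ and $\varphi$ is purely coclosed.
   Context: Notation: $e^{ij\cdots}=e^i\wedge e^j\wedge\cdots$; $d$ is the Chevalley–Eilenberg differential, $d\xi(x,y)=-\xi([x,y])$. $\mathfrak g$ is the Lie algebra of a connected Lie group $G$, and elements of $\Lambda^\bullet\mathfrak g^*$ are identified with left-invariant forms. The form $\varphi$ induces the inner product $g$ for which $\{e_i\}$ is orthonormal, and the orientation $e^{1234567}$, hence a Hodge star $\star$; put $\psi=\star\varphi$. $\varphi$ is coclosed if $d\psi=0$ (this is the case here), and purely coclosed if moreover $\varphi\wedge d\varphi=0$. For $\lambda\in\mathbb R$, the metric connection $\nabla^\lambda$ is defined by $g(\nabla^\lambda_xy,z)=g(\nabla^g_xy,z)+\frac\lambda2T(x,y,z)$ for $x,y,z\in\mathfrak g$, where $\nabla^g$ is the Levi-Civita connection of the left-invariant metric and $T=\frac16\star(d\varphi\wedge\varphi)\varphi-\star d\varphi$. Its curvature is $R^\lambda_{x,y}=\nabla^\lambda_x\nabla^\lambda_y-\nabla^\lambda_y\nabla^\lambda_x-\nabla^\lambda_{[x,y]}$.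 $\nabla^\lambda$ is a $\mathrm G_2$-instanton if $R^\lambda\wedge\psi=0$, i.e. for all $u,v\in\mathfrak g$ the 2-form $(x,y)\mapsto g(R^\lambda_{x,y}u,v)$ wedged with $\psi$ vanishes. *)

(* Defs.v *)
From HB Require Import structures.
From mathcomp Require Import all_boot all_order all_fingroup all_algebra.
From mathcomp Require Import reals.

Set Implicit Arguments.
Unset Strict Implicit.
Unset Printing Implicit Defensive.

Import Order.TTheory GRing.Theory Num.Theory.
Local Open Scope ring_scope.

Section LieAlgebra.
Variables (R : realType) (g : vectType R) (br : g -> g -> g).

Record is_lie_bracket : Prop := IsLieBracket {
  lie_linearl : forall y, linear (br^~ y);
  lie_linearr : forall x, linear (br x);
  lie_alt : forall x, br x x = 0;
  lie_jacobi : forall x y z,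
    br x (br y z) + br y (br z x) + br z (br x y) = 0 }.

(* Lower central series, indexed from 0: lcs 0 = g and lcs k.+1 = [g, lcs k]. *)
Fixpoint lcs (k : nat) : {vspace g} :=
  if k is k'.+1
  then <<[seq br x y | x <- vbasis {:g}, y <- vbasis (lcs k')]>>%VS
  else fullv.

Definition two_step_nilpotent : Prop := lcs 1 <> 0%VS /\ lcs 2 = 0%VS.

End LieAlgebra.

(* A k-form is stored as its values on k-tuples of vectors; every form built
   below is multilinear and alternating, but the type does not record it. *)
Definition kform (R : realType) (g : vectType R) (k : nat) : Type :=
  k.-tuple g -> R.

Section Forms.
Variables (R : realType) (g : vectType R).
Implicit Types (p q k : nat).

Definition form_eq0 k (al : kform g k) : Prop := forall v, al v = 0.

(* Normalized so that (xi /\ eta)(x, y) = xi x * eta y - xi y * eta x for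
   1-forms. *)
Definition wedge p q (al : kform g p) (be : kform g q) : kform g (p + q) :=
  fun v => (p`! * q`!)%:R^-1 *
    \sum_(s : 'S_(p + q)) (-1) ^+ s *
      (al [tuple tnth v (s (lshift q i)) | i < p] *
       be [tuple tnth v (s (rshift p j)) | j < q]).

(* Chevalley-Eilenberg differential:
     (d al)(v_0, ..., v_(k+1)) = \sum_(i < j') (-1)^(i + j')
       al([v_i, v_j'], v_0, ..., ^v_i, ..., ^v_j', ..., v_(k+1)),
   the pairs i < j' being parametrized by j' = lift i j = j + 1 with i <= j. *)
Definition ce_d (br : g -> g -> g) k (al : kform g k.+1) : kform g k.+2 :=
  fun v => \sum_(i < k.+2) \sum_(j < k.+1 | (i <= j)%N)
    (-1) ^+ (i + lift i j) *
    al [tuple of br (tnth v i) (tnth v (lift i j))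
              :: [tuple tnth v (lift i (lift j m)) | m < k]].

(* Hodge star of the metric for which e is orthonormal and of the volume form
   vol: the linear map sending e^I to vol(e_I, -), so that
   al /\ star be = <al, be> vol. *)
Definition star p q (e : (p + q).-tuple g) (vol : kform g (p + q))
    (al : kform g p) : kform g q :=
  fun v => p`!%:R^-1 *
    \sum_(f : {ffun 'I_p -> 'I_(p + q)})
      al [tuple tnth e (f i) | i < p] *
      vol [tuple of [tuple tnth e (f i) | i < p] ++ v].

End Forms.

Section G2.
Variables (R : realType) (g : vectType R) (e : 7.-tuple g).

(* The dual basis e^1, ..., e^7, numbered from 1 (use only for 1 <= i <= 7). *)
Definition dual (i : nat) : kform g 1 := fun v => coord e (inord i.-1) (thead v).

(* ext [:: i; j; ...] = e^i /\ e^j /\ ... *)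
Fixpoint ext (s : seq nat) : kform g (size s) :=
  match s return kform g (size s) with
  | [::] => fun=> 1
  | i :: s' => wedge (dual i) (@ext s')
  end.
Arguments ext s v : clear implicits.

Definition metric (x y : g) : R := \sum_(i < 7) coord e i x * coord e i y.

Definition vol : kform g 7 := ext [:: 1; 2; 3; 4; 5; 6; 7]%N.

Definition phi : kform g 3 := fun v =>
    ext [:: 1; 2; 7]%N v + ext [:: 3; 4; 7]%N v + ext [:: 5; 6; 7]%N v
  + ext [:: 1; 3; 5]%N v - ext [:: 1; 4; 6]%N v - ext [:: 2; 3; 6]%N v
  - ext [:: 2; 4; 5]%N v.

Definition psi : kform g 4 := @star R g 3 4 e vol phi.

Variable br : g -> g -> g.

Definition coclosed : Prop := form_eq0 (ce_d br psi).

Definition purely_coclosed : Prop :=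
  coclosed /\ form_eq0 (wedge phi (ce_d br phi)).

(* The 0-form star (d phi /\ phi) is evaluated at the empty tuple. *)
Definition torsion : kform g 3 := fun v =>
  6%:R^-1 * @star R g 7 0 e vol (wedge (ce_d br phi) phi) [tuple] * phi v
  - @star R g 4 3 e vol (ce_d br phi) v.

(* Left-invariant connections are the bilinear maps g -> g -> g. *)
Record is_levi_civita (D : g -> g -> g) : Prop := IsLeviCivita {
  lc_linearl : forall y, linear (D^~ y);
  lc_linearr : forall x, linear (D x);
  lc_torsion_free : forall x y, D x y - D y x = br x y;
  lc_metric : forall x y z, metric (D x y) z + metric y (D x z) = 0 }.

(* D is the connection nabla^la built from the Levi-Civita connection D0. *)
Definition is_nabla (D0 : g -> g -> g) (la : R) (D : g -> g -> g) : Prop :=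
  forall x y z,
    metric (D x y) z = metric (D0 x y) z + la / 2 * torsion [tuple x; y; z].

Definition curvature (D : g -> g -> g) (x y u : g) : g :=
  D x (D y u) - D y (D x u) - D (br x y) u.

Definition curvature_form (D : g -> g -> g) (u v : g) : kform g 2 :=
  fun w => metric (curvature D (tnth w ord0) (tnth w ord_max) u) v.

Definition G2_instanton (D : g -> g -> g) : Prop :=
  forall u v, form_eq0 (wedge (curvature_form D u v) psi).

End G2.

Arguments ext {R g} e s v.

(* Main.v *)
Require Import Defs.
From HB Require Import structures.
From mathcomp Require Import all_boot all_order all_fingroup all_algebra.
From mathcomp Require Import reals.
From mathcomp Require Import ring lra zify.

(** Put beta = de^7 and s = a + b + c, so that [x, y] = - beta(x, y) e_7.

    Every form that occurs is a combination of products e^(i_1 ... i_k), and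
    such a product is the determinant of the coordinates of its arguments.
    Wedge products then become concatenations of index lists
    ([wedge_comb_form]), Hodge stars become complements of index lists
    ([star_basic_form]), and d replaces e^7 by beta ([ce_d_basic_form7]).
    This gives d psi = 0 and d phi /\ phi = 2 s vol, so phi is purely coclosed
    iff s = 0 ([purely_coclosedE]), and it gives the torsion form T
    ([torsionE]).  With Koszul's formula for the Levi-Civita connection,
      g(nabla^la_x y, z) = S(x, y, z) + x_7 beta(y, z)
    where S = (la T - beta /\ e^7) / 2 is a 3-form ([nablaE]).

    Sufficiency ([instanton_sufficient]): if s = 0 then T = beta /\ e^7, hence
    S = 0 for la = 1.  The connection is then x |-> x_7 B with B the
    endomorphism dual to beta, its curvature form at (u, v) is beta(u, v) beta,
    and beta /\ psi = s e^123456 = 0.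

    Necessity ([instanton_necessary]): as psi = star phi, a 2-form F with
    F /\ psi = 0 satisfies sum_(p, q) F_pq phi_pqk = 0 for every k
    ([psi_contraction]).  Each nabla_(e_p) e_q is a multiple of a single e_r,
    so the components of the curvature are short polynomials in a, b, c, la
    ([curvature_evec]).  Seven of these contractions form a system whose only
    real solutions with (a, b, c) <> 0 have la = 1 and s = 0
    ([instanton_algebra]). *)

Set Implicit Arguments.
Unset Strict Implicit.
Unset Printing Implicit Defensive.

Import Order.TTheory GRing.Theory Num.Theory.
Local Open Scope ring_scope.

(** * Determinantal forms and their wedge products *)

Section BlockPerm.
Variables (p q : nat) (s : 'S_p) (t : 'S_q).

Definition block_fun (i : 'I_(p + q)) : 'I_(p + q) :=
  match split i with inl a => lshift q (s a) | inr b => rshift p (t b) end.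

Lemma block_fun_l a : block_fun (lshift q a) = lshift q (s a).
Proof. by rewrite /block_fun (unsplitK (inl a)). Qed.

Lemma block_fun_r b : block_fun (rshift p b) = rshift p (t b).
Proof. by rewrite /block_fun (unsplitK (inr b)). Qed.

Lemma block_fun_inj : injective block_fun.
Proof.
move=> i j; rewrite -[i]splitK -[j]splitK.
case: (split i) => a; case: (split j) => b /=;
  rewrite ?block_fun_l ?block_fun_r => /eqP;
  rewrite ?eq_lshift ?eq_rshift ?eq_lrshift ?eq_rlshift //.
- by move=> /eqP/perm_inj->.
- by move=> /eqP/perm_inj->.
Qed.

Definition block_perm : 'S_(p + q) := perm block_fun_inj.

Lemma block_permEl a : block_perm (lshift q a) = lshift q (s a).
Proof. by rewrite permE block_fun_l. Qed.

Lemma block_permEr b : block_perm (rshift p b) = rshift p (t b).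
Proof. by rewrite permE block_fun_r. Qed.

(** The signs are compared as determinants of permutation matrices, because the
    matrix of [block_perm] is block diagonal. *)
Lemma sign_block_perm (K : comNzRingType) :
  (-1) ^+ block_perm = (-1) ^+ s * (-1) ^+ t :> K.
Proof.
rewrite -!det_perm -(det_ublock _ 0); congr (\det _).
apply/matrixP => i j; rewrite -[i]splitK -[j]splitK.
case: (split i) => a; case: (split j) => b /=;
 rewrite ?block_mxEul ?block_mxEur ?block_mxEdl ?block_mxEdr !mxE
  ?block_permEl ?block_permEr.
- by rewrite eq_lshift.
- by rewrite eq_lrshift.
- by rewrite eq_rlshift.
- by rewrite eq_rshift.
Qed.
End BlockPerm.

Section DetForms.
Variables (R : realType) (g : vectType R).

Definition detform n (x : 'I_n -> g -> R) : kform g n :=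
  fun v => \det (\matrix_(i, j) x i (tnth v j)).

Lemma detformE n (x : 'I_n -> g -> R) v :
  detform x v = \sum_(s : 'S_n) (-1) ^+ s * \prod_i x i (tnth v (s i)).
Proof.
by apply: eq_bigr => s _; congr (_ * _); apply: eq_bigr => i _; rewrite mxE.
Qed.

Lemma detform_perm n (x : 'I_n -> g -> R) v (s : 'S_n) :
  detform x [tuple tnth v (s i) | i < n] = (-1) ^+ s * detform x v.
Proof.
have -> : (-1) ^+ s = \det (perm_mx s^-1 : 'M[R]_n) by rewrite det_perm odd_permV.
rewrite mulrC -det_mulmx -col_permE; congr (\det _).
by apply/matrixP => i j; rewrite !mxE tnth_mktuple.
Qed.

Definition cat_fun p q T (x : 'I_p -> T) (y : 'I_q -> T) (i : 'I_(p + q)) : T :=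
  match split i with inl a => x a | inr b => y b end.

Lemma cat_funl p q T (x : 'I_p -> T) (y : 'I_q -> T) a :
  cat_fun x y (lshift q a) = x a.
Proof. by rewrite /cat_fun (unsplitK (inl a)). Qed.

Lemma cat_funr p q T (x : 'I_p -> T) (y : 'I_q -> T) b :
  cat_fun x y (rshift p b) = y b.
Proof. by rewrite /cat_fun (unsplitK (inr b)). Qed.

Lemma eq_wedge p q (al al' : kform g p) (be be' : kform g q) :
  al =1 al' -> be =1 be' -> wedge al be =1 wedge al' be'.
Proof.
by move=> ha hb v; congr (_ * _); apply: eq_bigr => s _; rewrite ha hb.
Qed.

(** Laplace expansion along the first p rows, in the unnormalized form that sums
    over all of S_(p + q): expanding both factors, each pair (t, u) of
    permutations of the two blocks contributes one full determinant, after
    reindexing by [block_perm t u]; the p! q! pairs cancel the normalization. *)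
Lemma wedge_detform p q (x : 'I_p -> g -> R) (y : 'I_q -> g -> R) v :
  wedge (detform x) (detform y) v = detform (cat_fun x y) v.
Proof.
have fact_neq0 : (p`! * q`!)%:R != 0 :> R.
  by rewrite pnatr_eq0 -lt0n muln_gt0 !fact_gt0.
apply: (mulfI fact_neq0); rewrite /wedge mulrA divff // mul1r.
under eq_bigr do rewrite !detformE mulr_suml mulr_sumr.
rewrite exchange_big /=.
under eq_bigr => t _ do under eq_bigr do rewrite !mulr_sumr.
under eq_bigr => t _ do rewrite exchange_big /=.
have E (t : 'S_p) (u : 'S_q) : \sum_(s : 'S_(p + q)) (-1) ^+ s *
   ((-1) ^+ t * (\prod_i x i (tnth [tuple tnth v (s (lshift q i0)) | i0 < p] (t i))) *
    ((-1) ^+ u * (\prod_i y i (tnth [tuple tnth v (s (rshift p i0)) | i0 < q] (u i)))))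
   = detform (cat_fun x y) v.
  rewrite detformE [RHS](reindex_inj (mulgI (block_perm t u))) /=.
  apply: eq_bigr => s _; rewrite odd_permM signr_addb sign_block_perm.
  rewrite big_split_ord /=.
  under [in RHS]eq_bigr do rewrite cat_funl permM block_permEl.
  under [X in _ = _ * (_ * X)]eq_bigr do rewrite cat_funr permM block_permEr.
  under eq_bigr do rewrite tnth_mktuple.
  under [X in _ * (_ * (_ * X)) = _]eq_bigr do rewrite tnth_mktuple.
  have regroup (c t0 u0 X Y : R) :
    c * (t0 * X * (u0 * Y)) = t0 * u0 * c * (X * Y).
    by ring.
  exact: regroup.
under eq_bigr => t _ do under eq_bigr => u _ do rewrite E.
rewrite !sumr_const !card_Sn -mulrnA mulr_natl; congr (_ *+ _); by rewrite mulnC.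
Qed.

End DetForms.

(** * The Hodge star of a determinantal form *)

Section Star.
Variables (R : realType) (g : vectType R).

Lemma tnth_catl p q (t : p.-tuple g) (u : q.-tuple g) i :
  tnth [tuple of t ++ u] (lshift q i) = tnth t i.
Proof. by rewrite !(tnth_nth 0) /= nth_cat size_tuple ltn_ord. Qed.

Lemma tnth_catr p q (t : p.-tuple g) (u : q.-tuple g) i :
  tnth [tuple of t ++ u] (rshift p i) = tnth u i.
Proof.
by rewrite !(tnth_nth 0) /= nth_cat size_tuple ltnNge leq_addr /= addKn.
Qed.

(** Only the frames e_f with f = s o t^-1 pair nontrivially with the form
    e^(s_1) /\ ... /\ e^(s_p), and permuting the first p arguments of the volume
    form absorbs the sign of t; so the p! surviving terms are equal. *)
Lemma star_detform p q (e : (p + q).-tuple g) (vol : kform g (p + q))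
    (y : 'I_(p + q) -> g -> R) (s : 'I_p -> 'I_(p + q)) (v : q.-tuple g) :
  free e -> vol =1 detform y ->
  star e vol (detform (fun i => coord e (s i))) v =
    vol [tuple of [tuple tnth e (s i) | i < p] ++ v].
Proof.
move=> fre volE; rewrite /star.
have fact_neq0 : p`!%:R != 0 :> R by rewrite pnatr_eq0 -lt0n fact_gt0.
apply: (mulfI fact_neq0); rewrite mulrA divff // mul1r.
under eq_bigr do rewrite detformE mulr_suml.
rewrite exchange_big /= mulr_natl -card_Sn -sumr_const.
apply: eq_bigr => t _.
pose ft : {ffun 'I_p -> 'I_(p + q)} := [ffun i => s (t^-1%g i)].
have coef_ft : \prod_i coord e (s i) (tnth [tuple tnth e (ft i) | i < p] (t i)) = 1.
  apply: big1 => i _.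
  by rewrite tnth_mktuple ffunE permK (tnth_nth 0) coord_free // eqxx.
rewrite (bigD1 ft) //= [X in _ + X]big1 => [|f nf]; last first.
  have [i fi] : exists i, f (t i) != s i.
    apply/existsP; rewrite -negb_forall; apply: contra nf => /forallP ff.
    by apply/eqP/ffunP => i; rewrite ffunE -(eqP (ff _)) permKV.
  rewrite (bigD1 i) //= tnth_mktuple (tnth_nth 0) coord_free //.
  by rewrite (negbTE fi) !(mul0r, mulr0).
rewrite addr0 coef_ft mulr1 !volE.
pose w := [tuple of [tuple tnth e (s i) | i < p] ++ v].
have -> : [tuple of [tuple tnth e (ft i) | i < p] ++ v] =
          [tuple tnth w (block_perm t^-1 1 i) | i < p + q].
  apply: eq_from_tnth => i; rewrite tnth_mktuple -[i]splitK.
  case: (split i) => j /=.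
  - by rewrite block_permEl !tnth_catl !tnth_mktuple ffunE.
  - by rewrite block_permEr !tnth_catr perm1.
by rewrite detform_perm sign_block_perm odd_perm1 mulr1 odd_permV mulrA -signr_addb addbb mul1r.
Qed.

End Star.

(** * Laplace expansions *)

Section Laplace.
Variables (R : realType) (g : vectType R).

Lemma eq_detform n (x y : 'I_n -> g -> R) v :
  (forall i, x i =1 y i) -> detform x v = detform y v.
Proof. by move=> xy; congr (\det _); apply/matrixP=> i j; rewrite !mxE xy. Qed.

Lemma detform_row n (x : 'I_n.+1 -> g -> R) v :
  detform x v = \sum_(k < n.+1) (-1) ^+ k * x ord0 (tnth v k) *
    detform (x \o lift ord0) [tuple tnth v (lift k m) | m < n].
Proof.
rewrite {1}/detform (expand_det_row _ ord0); apply: eq_bigr => k _.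
rewrite mxE /cofactor mulrCA mulrA; congr (_ * _ * \det _).
by apply/matrixP => i j; rewrite !mxE tnth_mktuple.
Qed.

(** The pair (i, j) names the ordered pair of distinct positions
    (i, lift i j); this involution is the exchange of the two positions. *)
Definition swap_pair n (u : 'I_n.+2 * 'I_n.+1) : 'I_n.+2 * 'I_n.+1 :=
  (lift u.1 u.2, inord (if (u.1 <= u.2)%N then u.1 : nat else u.1.-1)).

Lemma val_swap_pair2 n (i : 'I_n.+2) (j : 'I_n.+1) :
  (swap_pair (i, j)).2 = (if (i <= j)%N then i : nat else i.-1) :> nat.
Proof.
rewrite /= inordK //; have := ltn_ord i; have := ltn_ord j.
move: (nat_of_ord i) (nat_of_ord j) => a b; case: (leqP a b) => ab hb ha. all: lia.
Qed.

Lemma swap_pairK n : involutive (@swap_pair n).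
Proof.
move=> [i j]; apply: injective_projections; apply/val_inj.
  change (bump (bump i j) (swap_pair (i, j)).2 = i).
  rewrite val_swap_pair2 /bump.
  by move: (nat_of_ord i) (nat_of_ord j) => a b; case: (leqP a b) => ab; lia.
rewrite [swap_pair (i, j)]surjective_pairing.
change (nat_of_ord (swap_pair ((swap_pair (i, j)).1, (swap_pair (i, j)).2)).2 = j).
rewrite val_swap_pair2 val_swap_pair2.
change ((if (bump i j <= (if (i <= j)%N then i : nat else i.-1))%N then bump i j
   else (bump i j).-1) = j).
rewrite /bump; move: (nat_of_ord i) (nat_of_ord j) => a b.
by case: (leqP a b) => ab; case: ifP; lia.
Qed.

Lemma lift_swap n (i : 'I_n.+2) (j : 'I_n.+1) (m : 'I_n) :
  lift (swap_pair (i, j)).1 (lift (swap_pair (i, j)).2 m) = lift i (lift j m).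
Proof.
apply/val_inj.
change (bump (bump i j) (bump (swap_pair (i, j)).2 m) = bump i (bump j m)).
rewrite val_swap_pair2 /bump.
move: (nat_of_ord i) (nat_of_ord j) (nat_of_ord m) => a b c.
by case: (leqP a b) => ab; lia.
Qed.

(** Laplace expansion along the first two rows, grouped by unordered pairs of
    columns: this is the shape of the Chevalley-Eilenberg differential, which is
    why the pairs are parametrized as in [ce_d]. *)
Lemma detform_two_rows n (x : 'I_n.+2 -> g -> R) v :
  detform x v = \sum_(i < n.+2) \sum_(j < n.+1 | (i <= j)%N)
    (-1) ^+ (i + lift i j) *
    (- (x ord0 (tnth v i) * x (lift ord0 ord0) (tnth v (lift i j))
       - x ord0 (tnth v (lift i j)) * x (lift ord0 ord0) (tnth v i)) *
    detform (x \o lift ord0 \o lift ord0)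
      [tuple tnth v (lift i (lift j m)) | m < n]).
Proof.
pose D (i : 'I_n.+2) (j : 'I_n.+1) := detform (x \o lift ord0 \o lift ord0)
      [tuple tnth v (lift i (lift j m)) | m < n].
pose F (i : 'I_n.+2) (j : 'I_n.+1) := (-1) ^+ i * x ord0 (tnth v i) *
   ((-1) ^+ j * x (lift ord0 ord0) (tnth v (lift i j)) * D i j).
have -> : detform x v = \sum_i \sum_j F i j.
  rewrite detform_row; apply: eq_bigr => i _.
  rewrite detform_row mulr_sumr; apply: eq_bigr => j _.
  rewrite /F /= tnth_mktuple; congr (_ * (_ * _)); rewrite /D.
  by congr (detform _ _); apply: eq_from_tnth => m; rewrite !tnth_mktuple.
rewrite pair_big_dep /= (bigID (fun u : 'I_n.+2 * 'I_n.+1 => (u.1 <= u.2)%N)) /=.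
rewrite [X in _ + X](reindex_inj (inv_inj (@swap_pairK n))) /=.
rewrite [RHS]pair_big_dep /=.
rewrite [X in _ + X](eq_bigl (fun u : 'I_n.+2 * 'I_n.+1 => (u.1 <= u.2)%N)); last first.
  move=> [i j]; have := val_swap_pair2 i j => /= ->.
  move: (nat_of_ord i) (nat_of_ord j) => a b; rewrite /bump ?andbT.
  by case: (leqP a b) => ab; lia.
rewrite -big_split /=; apply: eq_bigr => -[i j] /= ij.
have lij : lift i j = j.+1 :> nat by rewrite /= /bump ij.
have -> : F (lift i j) (inord (if (i <= j)%N then i : nat else i.-1)) =
  (-1) ^+ (i + lift i j) *
   (x ord0 (tnth v (lift i j)) * x (lift ord0 ord0) (tnth v i) * D i j).
  have := val_swap_pair2 i j; have := congr1 fst (swap_pairK (i, j)).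
  have dE : D (lift i j) (swap_pair (i, j)).2 = D i j.
    rewrite /D; congr (detform _ _); apply: eq_from_tnth => m.
    by rewrite !tnth_mktuple -[in RHS](lift_swap i j m).
  move: dE; rewrite [(swap_pair (i, j))]surjective_pairing /=.
  set h := inord _ => dE; rewrite ij => liftE hE.
  rewrite /F dE liftE hE exprD -[bump i j]/(nat_of_ord (lift i j)); ring.
rewrite -[bump i j]/(nat_of_ord (lift i j)) /F lij exprD exprS -/(D i j); ring.
Qed.
End Laplace.

(** * Signs of index permutations and the coefficients of psi *)

(** The determinant of the Kronecker deltas between two index lists, by row
    expansion.  It is an integer so that the signs of concrete permutations of
    indices can be evaluated by computation. *)
Fixpoint gdelta (u w : seq nat) : int :=
  if u is i :: u' then
    foldr (fun k acc => if i == nth 0%N w k then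
             (-1) ^+ k * gdelta u' (take k w ++ drop k.+1 w) + acc else acc)
      0 (iota 0 (size w))
  else 1.

Lemma gdelta_det (K : comNzRingType) n u w : size u = n -> size w = n ->
  \det (\matrix_(i < n, j < n) (nth 0%N u i == nth 0%N w j)%:R) =
    (gdelta u w)%:~R :> K.
Proof.
elim: n u w => [|n IH] [|i u] w //= => [_ _|[su] sw]; first by rewrite det_mx00.
rewrite (expand_det_row _ ord0).
have foldE s (f : nat -> int) : (foldr (fun k acc => if i == nth 0%N w k then
    f k + acc else acc) 0 s)%:~R =
    \sum_(k <- s) (i == nth 0%N w k)%:R * (f k)%:~R :> K.
  elim: s => [|k s IHs] /=; first by rewrite big_nil.
  by rewrite big_cons -IHs; case: eqP => _; rewrite ?mul1r ?mul0r ?add0r ?intrD.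
rewrite foldE sw -/(index_iota 0 n.+1) big_mkord; apply: eq_bigr => k _.
rewrite mxE /cofactor; congr (_ * _).
rewrite intrM rmorphXn /= rmorphN1 add0n -IH //; last first.
  by rewrite size_cat size_take size_drop sw; have := ltn_ord k; case: ltnP; lia.
congr (_ * \det _); apply/matrixP => a b; rewrite !mxE /=; congr (_ == _)%:R.
rewrite nth_cat size_take sw ltn_ord nth_drop /bump.
case: (ltnP b k) => kb /=; first by rewrite nth_take.
by congr nth; lia.
Qed.

Ltac compute_signs :=
  repeat match goal with |- context [gdelta ?u ?w] =>
    let z := eval vm_compute in (gdelta u w) in
    replace (gdelta u w) with z by (vm_compute; reflexivity) end.

Lemma signsE (K : pzRingType) :
  (((Posz 1)%:~R = 1 :> K) * ((Negz 0)%:~R = -1 :> K) * ((Posz 0)%:~R = 0 :> K))%type.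
Proof. by rewrite NegzE. Qed.

Definition psi_signs : seq (int * seq nat) :=
  [:: (1, [:: 3; 4; 5; 6]%N); (1, [:: 1; 2; 5; 6]%N); (1, [:: 1; 2; 3; 4]%N);
      (1, [:: 7; 2; 4; 6]%N); (-1, [:: 7; 2; 3; 5]%N); (-1, [:: 7; 1; 4; 5]%N);
      (-1, [:: 7; 1; 3; 6]%N)].

(** The coefficient of e^(1 ... ^k ... 7) in e^(pq) /\ psi.  Since psi = star phi,
    it is phi_(pqk) up to a sign that depends on k only. *)
Definition psi_coef (k p q : nat) : int :=
  foldr (fun x acc => x.1 * gdelta (p :: q :: x.2) (rem k (iota 1 7)) + acc) 0 psi_signs.

Arguments psi_coef : simpl never.

Ltac compute_coefs :=
  repeat match goal with |- context [psi_coef ?k ?p ?q] =>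
    let z := eval vm_compute in (psi_coef k p q) in
    replace (psi_coef k p q) with z by (vm_compute; reflexivity) end.

Definition psi_support k : seq (nat * nat) :=
  [seq u <- [seq (p, q) | p <- iota 1 7, q <- iota 1 7] | psi_coef k u.1 u.2 != 0].

(** * The polynomial system *)

(** If s = 0 then U x = x^2 (1 - l)^2 / 4, and a nonzero x among a, b, c forces
    l = 1.  If s <> 0, the squares and the products recombine into s^2 in
    U a + U b + U c + 2 (V a b + V a c + V b c), which leaves
    (l + 1)(5 l - 9) = 0; at l = -1 the equation U a = 0, and at l = 9/5 the last
    equation, become a sum of two squares equal to zero, one of them positive. *)
Lemma instanton_algebra (K : realFieldType) (a b c l : K) :
  let s := a + b + c in
  let U x := x ^+ 2 * (1 - l) ^+ 2 / 4 + x * s * (- l ^+ 2 / 3 + 5 * l / 6 + 1 / 2)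
     - l * s ^+ 2 / 3 in
  let V x y := x * y * (1 - l) ^+ 2 / 4 - (x + y) * s * (l ^+ 2 - 3 * l) / 12 in
  ~ [/\ a = 0, b = 0 & c = 0] ->
  [/\ U a = 0, U b = 0 & U c = 0] -> [/\ V a b = 0, V a c = 0 & V b c = 0] ->
  (1 + l) * (a ^+ 2 * (1 - l) / 4 - l * s * (s - a) / 6) = 0 ->
  l = 1 /\ s = 0.
Proof.
move=> s U V abc [Ua Ub Uc] [Vab Vac Vbc] W.
have [s0|s0] := eqVneq s 0.
  split=> //; apply/eqP; apply: contra_notT abc => l1.
  have l1' : 1 - l != 0 by rewrite subr_eq0 eq_sym.
  have sq0 x : U x = 0 -> x = 0.
    rewrite /U s0 => Ux; have /eqP : x ^+ 2 * (1 - l) ^+ 2 = 0 by lra.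
    by rewrite mulf_eq0 !expf_eq0 /= (negbTE l1') orbF => /eqP.
  by split; apply: sq0.
exfalso.
have sq_gt0 : 0 < s ^+ 2 by rewrite exprn_even_gt0.
have : s ^+ 2 * ((l + 1) * (5 * l - 9)) = 0.
  transitivity (-12 * (U a + U b + U c + 2 * (V a b + V a c + V b c))).
    by rewrite /U /V /s; field; rewrite ?pnatr_eq0.
  by rewrite Ua Ub Uc Vab Vac Vbc; ring.
move/eqP; rewrite !mulf_eq0 (negbTE s0) /= => /orP[]/eqP hl.
  have lE : l = -1 by lra.
  have : (a - s / 3) ^+ 2 + 2 / 9 * s ^+ 2 = 0.
    by rewrite -[RHS]Ua /U lE; field; rewrite ?pnatr_eq0.
  have := sqr_ge0 (a - s / 3); lra.
have lE : l = 9 / 5 by lra.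
have : (a - 3 / 4 * s) ^+ 2 + 15 / 16 * s ^+ 2 = 0.
  apply: (mulfI (_ : - (14 / 25) != 0)); first by lra.
  by rewrite mulr0 -[RHS]W lE; field; rewrite ?pnatr_eq0.
have := sqr_ge0 (a - 3 / 4 * s); lra.
Qed.

(** * Forms written in the coframe e^1, ..., e^7 *)

Section LeftInvariantForms.
Variables (R : realType) (g : vectType R) (e : 7.-tuple g).

Definition crd (i : nat) (x : g) : R := coord e (inord i.-1) x.
Definition evec (i : nat) : g := tnth e (inord i.-1).

(** The product e^(s_1) /\ ... /\ e^(s_n); the degree n is separate from the list s
    so that degrees are not tied to sizes of concatenated lists. *)
Definition basic_form n (s : seq nat) : kform g n :=
  detform (fun i : 'I_n => crd (nth 0%N s i)).

Arguments basic_form : clear implicits.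

Definition comb_form n (F : seq (R * seq nat)) : kform g n :=
  fun v => \sum_(x <- F) x.1 * basic_form n x.2 v.

Arguments comb_form : clear implicits.

Lemma crdD i x y : crd i (x + y) = crd i x + crd i y.
Proof. exact: linearD. Qed.

Lemma crdZ i k x : crd i (k *: x) = k * crd i x.
Proof. exact: linearZ. Qed.

Lemma crdN i x : crd i (- x) = - crd i x.
Proof. exact: linearN. Qed.

Lemma wedge_basic_form p q s t v : size s = p ->
  wedge (basic_form p s) (basic_form q t) v = basic_form (p + q) (s ++ t) v.
Proof.
move=> ss; rewrite wedge_detform; apply: eq_detform => i x.
rewrite -[i]splitK; case: (split i) => j /=;
  rewrite ?cat_funl ?cat_funr nth_cat ss /= ?ltn_ord //.
by rewrite ltnNge leq_addr /= addKn.
Qed.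

Lemma ext_basic_form s v : ext e s v = basic_form (size s) s v.
Proof.
elim: s v => [|i s IH] v; first by rewrite /basic_form /detform det_mx00.
rewrite -[RHS](@wedge_basic_form 1 (size s) [:: i]) //=.
apply: eq_wedge => // w.
by rewrite /basic_form /detform det_mx11 mxE /= /dual /crd (tnth_nth 0) /thead (tnth_nth 0).
Qed.

(** The rows of the matrix on the left are selected from those of the matrix on
    the right, i.e. it is the product with a matrix of Kronecker deltas. *)
Lemma basic_form_top n u v : size u = n -> all (mem (iota 1 n)) u ->
  basic_form n u v = (gdelta u (iota 1 n))%:~R * basic_form n (iota 1 n) v.
Proof.
move=> su /allP uin; rewrite -(gdelta_det _ su) ?size_iota // -det_mulmx.
congr (\det _); apply/matrixP => i j; rewrite !mxE.
have : nth 0%N u i \in iota 1 n by apply: uin; rewrite mem_nth ?su.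
rewrite mem_iota => hi.
have hk : ((nth 0%N u i).-1 < n)%N by lia.
rewrite (bigD1 (Ordinal hk)) //= big1 ?addr0 => [|k nk].
  by rewrite !mxE nth_iota //= add1n prednK ?eqxx ?mul1r //; lia.
rewrite !mxE nth_iota // add1n; case: eqP => [uk|]; last by rewrite mul0r.
by case/eqP: nk; apply/val_inj; rewrite /= uk.
Qed.

Lemma basic_form_eq0 n u v : size u = n -> ~~ uniq u -> basic_form n u v = 0.
Proof.
move=> su /(uniqPn 0%N)[i [j [ij jn uij]]].
rewrite su in jn; have iN := ltn_trans ij jn.
apply: (@determinant_alternate _ _ _ (Ordinal iN) (Ordinal jn)).
  by rewrite -val_eqE /= neq_ltn ij.
by move=> k; rewrite !mxE /= uij.
Qed.

(** If x is annihilated by all the coordinates in t, the first column of the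
    determinant has a single possibly nonzero entry. *)
Lemma basic_form_head n i t x (w : n.-tuple g) :
  (forall j, j \in t -> crd j x = 0) -> size t = n ->
  basic_form n.+1 (i :: t) [tuple of x :: w] = crd i x * basic_form n t w.
Proof.
move=> tx st; rewrite /basic_form /detform (expand_det_col _ ord0) big_ord_recl big1.
  rewrite addr0 !mxE /= /cofactor /= mul1r.
  congr (_ * \det _); apply/matrixP => a b; rewrite !mxE /=.
  by rewrite !(tnth_nth 0).
by move=> k _; rewrite mxE /= tx ?mul0r ?mem_nth ?st ?ltn_ord.
Qed.

Lemma basic_form_head0 n s x (w : n.-tuple g) :
  (forall j, j \in s -> crd j x = 0) -> size s = n.+1 ->
  basic_form n.+1 s [tuple of x :: w] = 0.
Proof.
case: s => [|i s] // sx [ss]; rewrite basic_form_head //.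
  by rewrite sx ?mul0r // mem_head.
by move=> j js; rewrite sx // in_cons js orbT.
Qed.

Lemma basic_form2E i j x y :
  basic_form 2 [:: i; j] [tuple x; y] = crd i x * crd j y - crd i y * crd j x.
Proof.
rewrite /basic_form detform_row !big_ord_recl big_ord0 /= /detform !det_mx11 !mxE /=.
by rewrite !tnth_mktuple !(tnth_nth 0) /= expr0 expr1; ring.
Qed.

Lemma basic_form3E i j k x y z :
  basic_form 3 [:: i; j; k] [tuple x; y; z] =
    crd i x * (crd j y * crd k z - crd j z * crd k y)
  - crd i y * (crd j x * crd k z - crd j z * crd k x)
  + crd i z * (crd j x * crd k y - crd j y * crd k x).
Proof.
rewrite /basic_form detform_row !big_ord_recl big_ord0.
have fE a b : detform ((fun m : 'I_3 => crd (nth 0%N [:: i; j; k] m)) \o lift ord0) 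
  [tuple of [:: a; b]] = crd j a * crd k b - crd j b * crd k a.
  by rewrite -basic_form2E; apply: eq_detform.
have tE a b (v : 2.-tuple g) : tnth v ord0 = a -> tnth v ord_max = b -> 
  v = [tuple a; b].
  move=> va vb; apply: eq_from_tnth => m.
  case: m => -[|[|m]] // hm; rewrite [RHS](tnth_nth 0) /=.
    by rewrite -va; congr (tnth _ _); apply/val_inj.
  by rewrite -vb; congr (tnth _ _); apply/val_inj.
rewrite [X in detform _ X](tE y z) ?tnth_mktuple //.
rewrite [X in _ + (_ * detform _ X + _)](tE x z) ?tnth_mktuple //.
rewrite [X in _ + (_ + (_ * detform _ X + _))](tE x y) ?tnth_mktuple //.
rewrite !fE /= !(tnth_nth 0) /=; ring.
Qed.

Lemma eq_star p q (e' : (p + q).-tuple g) vol (al al' : kform g p) :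
  al =1 al' -> star (q := q) e' vol al =1 star e' vol al'.
Proof.
by move=> aa v; congr (_ * _); apply: eq_bigr => f _; rewrite aa.
Qed.

(** Filling the first p arguments of vol with e_(s_1), ..., e_(s_p) makes the
    matrix of e^(s ++ t) block triangular with an identity block, and the other
    diagonal block is the matrix of e^t.  The tuple e' is e itself, with its
    length written as a sum. *)
Lemma star_basic_form p q (e' : (p + q).-tuple g) (vol : kform g (p + q)) s t v :
  free e' -> (forall i, coord e' i =1 crd i.+1) ->
  vol =1 basic_form (p + q) (iota 1 (p + q)) ->
  size s = p -> size t = q -> perm_eq (s ++ t) (iota 1 (p + q)) ->
  gdelta (s ++ t) (iota 1 (p + q)) = 1 ->
  star e' vol (basic_form p s) v = basic_form q t v.
Proof.
move=> fre' coordE volE ss st stE kd1.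
have lt_s (i : 'I_p) : ((nth 0%N s i).-1 < p + q)%N /\ (0 < nth 0%N s i)%N.
  have : nth 0%N s i \in s ++ t by rewrite mem_cat mem_nth ?ss.
  rewrite (perm_mem stE) mem_iota; lia.
pose s' i := Ordinal (lt_s i).1.
have s'E i : (s' i).+1 = nth 0%N s i by rewrite /= prednK //; case: (lt_s i).
have -> : star e' vol (basic_form p s) v =
    star e' vol (detform (fun i => coord e' (s' i))) v.
  by apply: eq_star => w; apply: eq_detform => i x; rewrite coordE s'E.
rewrite (star_detform _ _ fre' volE) volE; set w := [tuple of _ ++ _].
have uniq_st : uniq (s ++ t) by rewrite (perm_uniq stE) iota_uniq.
have s'_inj : injective s'.
  move=> i j /(congr1 (fun k : 'I__ => k.+1)); rewrite !s'E => /eqP.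
  rewrite nth_uniq ?ss ?ltn_ord //; first by move/eqP/val_inj.
  by move: uniq_st; rewrite cat_uniq => /andP[].
have <- : basic_form (p + q) (s ++ t) w = basic_form q t v.
  rewrite -[RHS]mul1r -(det1 _ p) -(det_ublock _
    (\matrix_(i, j) crd (nth 0%N s i) (tnth v j))); congr (\det _).
  apply/matrixP => i j; rewrite mxE -[i]splitK -[j]splitK.
  case: (split i) => a; case: (split j) => b /=;
    rewrite ?(block_mxEul, block_mxEur, block_mxEdl, block_mxEdr) !mxE
            ?(tnth_catl, tnth_catr, tnth_mktuple) nth_cat ss ?ltn_ord //=.
  - rewrite -(s'E a) -coordE (tnth_nth 0) coord_free // (inj_eq s'_inj).
    by rewrite eq_sym.
  - rewrite ltnNge leq_addr /= addKn.
    have ta : nth 0%N t a \in t by rewrite mem_nth ?st.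
    have : nth 0%N t a \in s ++ t by rewrite mem_cat ta orbT.
    rewrite (perm_mem stE) mem_iota => hta.
    have lt_ta : ((nth 0%N t a).-1 < p + q)%N by lia.
    have taE : (Ordinal lt_ta).+1 = nth 0%N t a by rewrite /= prednK //; lia.
    rewrite -taE -coordE (tnth_nth 0) coord_free //.
    case: eqP => // /(congr1 (fun k : 'I__ => k.+1)); rewrite s'E taE => tsE.
    move: uniq_st; rewrite cat_uniq => /and3P[_ /hasPn/(_ _ ta)].
    by rewrite -tsE mem_nth ?ss.
  - by rewrite ltnNge leq_addr /= addKn.
rewrite (basic_form_top (u := s ++ t)); last 2 first.
- by rewrite size_cat ss st.
- by apply/allP => i; rewrite (perm_mem stE).
by rewrite kd1 mul1r.
Qed.

Lemma star_comb_form p q (e' : (p + q).-tuple g) vol (F : seq (R * seq nat)) v :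
  star (q := q) e' vol (comb_form p F) v =
    \sum_(x <- F) x.1 * star e' vol (basic_form p x.2) v.
Proof.
rewrite /star /comb_form; under eq_bigr do rewrite mulr_suml.
rewrite exchange_big /= mulr_sumr; apply: eq_bigr => x _.
by rewrite mulrCA; congr (_ * _);
  rewrite mulr_sumr; apply: eq_bigr => f _; rewrite mulrA.
Qed.

Definition wedge_terms (F G : seq (R * seq nat)) :=
  [seq (x.1 * y.1, x.2 ++ y.2) | x <- F, y <- G].

Lemma wedge_comb_form p q F G v : all (fun x => size x.2 == p) F ->
  wedge (comb_form p F) (comb_form q G) v = comb_form (p + q) (wedge_terms F G) v.
Proof.
move=> szF; rewrite /comb_form [RHS]big_allpairs_dep /wedge /=.
set c := (_ %:R)^-1.
have expand (s : 'S_(p + q)) (X Y : R * seq nat -> R) :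
    (-1) ^+ s * ((\sum_(x <- F) x.1 * X x) * \sum_(y <- G) y.1 * Y y) =
    \sum_(x <- F) \sum_(y <- G) (x.1 * y.1) * ((-1) ^+ s * (X x * Y y)).
  rewrite mulr_suml mulr_sumr; apply: eq_bigr => x _.
  rewrite mulr_sumr mulr_sumr; apply: eq_bigr => y _.
  by set sg := (-1) ^+ s; ring.
rewrite [X in c * X](eq_bigr _ (fun s _ => expand s _ _)) /=.
rewrite exchange_big mulr_sumr big_seq [RHS]big_seq; apply: eq_bigr => x xF.
rewrite exchange_big mulr_sumr; apply: eq_bigr => y _.
rewrite -(wedge_basic_form _ _ (eqP (allP szF x xF))) /wedge -mulr_sumr.
exact: mulrCA.
Qed.

Lemma comb_form_top n F v :
  all (fun x => (size x.2 == n) && all (mem (iota 1 n)) x.2) F ->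
  comb_form n F v =
    (\sum_(x <- F) x.1 * (gdelta x.2 (iota 1 n))%:~R) * basic_form n (iota 1 n) v.
Proof.
move=> wf; rewrite /comb_form mulr_suml big_seq [RHS]big_seq.
apply: eq_bigr => x /(allP wf)/andP[/eqP sx sub].
by rewrite -mulrA -(basic_form_top _ sx).
Qed.

Lemma ce_d_dual (br : g -> g -> g) i x y :
  ce_d br (dual e i) [tuple x; y] = - crd i (br x y).
Proof.
rewrite /ce_d !big_ord_recl !big_ord0 /= !big_mkcond !big_ord_recl !big_ord0 /=.
rewrite !addr0 expr1 mulN1r /dual /crd /thead !(tnth_nth 0) /=; congr (- coord _ _ (br _ _)).
Qed.

(** * The G2-structure *)

Hypothesis he : basis_of fullv e.

Lemma crd_evec i j : (0 < i <= 7)%N -> (0 < j <= 7)%N ->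
  crd i (evec j) = (i == j)%:R.
Proof.
move=> hi hj; rewrite /crd /evec (tnth_nth 0) coord_free ?(basis_free he) //.
congr (_)%:R; rewrite -val_eqE /= !inordK; lia.
Qed.

Lemma crd_sum x : x = \sum_(i <- iota 1 7) crd i x *: evec i.
Proof.
rewrite {1}(coord_basis he (memvf x)) -[7%N]/(8 - 1)%N -/(index_iota 1 8).
rewrite big_add1 big_mkord; apply: eq_bigr => i _.
by rewrite /crd /evec /= inord_val (tnth_nth 0).
Qed.

Lemma metricE x y : metric e x y = \sum_(i <- iota 1 7) crd i x * crd i y.
Proof.
rewrite /metric -[7%N]/(8 - 1)%N -/(index_iota 1 8) big_add1 big_mkord.
by apply: eq_bigr => i _; rewrite /crd /= inord_val.
Qed.

Lemma metric_evec x i : (0 < i <= 7)%N -> metric e x (evec i) = crd i x.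
Proof.
move=> hi; have hi' : i \in iota 1 7 by rewrite mem_iota.
have rest0 : \sum_(j <- iota 1 7 | j != i) crd j x * crd j (evec i) = 0.
  rewrite big_seq_cond big1 // => j /andP[]; rewrite mem_iota => hj ji.
  by rewrite crd_evec // (negbTE ji) mulr0.
rewrite metricE (bigD1_seq i hi' (iota_uniq _ _)) rest0.
by rewrite crd_evec // eqxx mulr1; apply: addr0.
Qed.

(** The index 7 is put first because the bracket takes its values in the line of
    e_7: [ce_d_basic_form7] differentiates the head of the list. *)
Definition phi_terms : seq (R * seq nat) :=
  [:: (1, [:: 7; 1; 2]%N); (1, [:: 7; 3; 4]%N); (1, [:: 7; 5; 6]%N);
      (1, [:: 1; 3; 5]%N); (-1, [:: 1; 4; 6]%N); (-1, [:: 2; 3; 6]%N);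
      (-1, [:: 2; 4; 5]%N)].

Lemma tuple3_eta (v : 3.-tuple g) : exists x y z, v = [tuple x; y; z].
Proof.
case/tupleP: v => x v; case/tupleP: v => y v; case/tupleP: v => z v.
by exists x, y, z; rewrite (tuple0 v); apply/val_inj.
Qed.

Lemma tuple2_eta (v : 2.-tuple g) : exists x y, v = [tuple x; y].
Proof.
case/tupleP: v => x v; case/tupleP: v => y v.
by exists x, y; rewrite (tuple0 v); apply/val_inj.
Qed.

Lemma phiE : phi e =1 comb_form 3 phi_terms.
Proof.
move=> v; have [x [y [z ->]]] := tuple3_eta v.
rewrite /phi !ext_basic_form /comb_form !big_cons big_nil /= !basic_form3E; ring.
Qed.

Lemma volE : vol e =1 basic_form 7 (iota 1 7).
Proof. by move=> v; rewrite /vol ext_basic_form. Qed.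

Definition psi_terms : seq (R * seq nat) :=
  [seq (x.1%:~R, x.2) | x <- psi_signs].

Lemma coord_crd (i : 'I_7) : coord e i =1 crd i.+1.
Proof. by move=> x; rewrite /crd /= inord_val. Qed.

(** Each complement is ordered so that it completes the triple to an even
    permutation of 1, ..., 7. *)
Lemma psiE : psi e =1 comb_form 4 psi_terms.
Proof.
move=> v; rewrite /psi (eq_star _ _ phiE) star_comb_form /comb_form !big_cons !big_nil /=.
pose S s t (hs : size s = 3) (ht : size t = 4) :=
  @star_basic_form 3 4 e (vol e) s t v (basis_free he) coord_crd volE hs ht.
rewrite (S [:: 7; 1; 2]%N [:: 3; 4; 5; 6]%N) //.
rewrite (S [:: 7; 3; 4]%N [:: 1; 2; 5; 6]%N) //.
rewrite (S [:: 7; 5; 6]%N [:: 1; 2; 3; 4]%N) //.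
rewrite (S [:: 1; 3; 5]%N [:: 7; 2; 4; 6]%N) //.
rewrite (S [:: 1; 4; 6]%N [:: 7; 2; 3; 5]%N) //.
rewrite (S [:: 2; 3; 6]%N [:: 7; 1; 4; 5]%N) //.
rewrite (S [:: 2; 4; 5]%N [:: 7; 1; 3; 6]%N) //.
Qed.

Lemma vol_basis : vol e e = 1.
Proof.
rewrite volE /basic_form /detform -[RHS](det1 _ 7); congr (\det _).
apply/matrixP => i j; rewrite !mxE nth_iota // add1n -coord_crd (tnth_nth 0).
by rewrite coord_free ?(basis_free he) // eq_sym.
Qed.

(** * The instanton condition on a 2-form *)

Section TwoForm.
Variable f : g -> g -> R.
Hypothesis f_linl : forall k x x' y, f (k *: x + x') y = k * f x y + f x' y.
Hypothesis f_linr : forall k x y y', f x (k *: y + y') = k * f x y + f x y'.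
Hypothesis f_alt : forall x, f x x = 0.

Lemma two_form_anti x y : f y x = - f x y.
Proof.
have f1l x1 x2 y1 : f (x1 + x2) y1 = f x1 y1 + f x2 y1.
  by rewrite -[x1]scale1r f_linl mul1r scale1r.
have f1r x1 x2 y1 : f y1 (x1 + x2) = f y1 x1 + f y1 x2.
  by rewrite -[x1]scale1r f_linr mul1r scale1r.
have := f_alt (x + y); rewrite f1l !f1r !f_alt; lra.
Qed.

Lemma two_form_sum x y : f x y = \sum_(p <- iota 1 7) \sum_(q <- iota 1 7)
   crd p x * crd q y * f (evec p) (evec q).
Proof.
have f0l z : f 0 z = 0.
  by have := f_linl 1 0 0 z; rewrite scale1r addr0; lra.
have f0r z : f z 0 = 0.
  by have := f_linr 1 z 0 0; rewrite scale1r addr0; lra.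
have suml (s : seq nat) (h : nat -> R) z : f (\sum_(p <- s) h p *: evec p) z =
   \sum_(p <- s) h p * f (evec p) z.
  by elim: s => [|p s IH]; rewrite ?big_nil ?f0l // !big_cons f_linl IH.
have sumr (s : seq nat) (h : nat -> R) z : f z (\sum_(p <- s) h p *: evec p) =
   \sum_(p <- s) h p * f z (evec p).
  by elim: s => [|p s IH]; rewrite ?big_nil ?f0r // !big_cons f_linr IH.
rewrite {1}(crd_sum x) suml; apply: eq_bigr => p _.
rewrite {1}(crd_sum y) sumr mulr_sumr; apply: eq_bigr => q _.
exact: mulrA.
Qed.

Definition two_form_terms :=
  [seq (f (evec p) (evec q) / 2, [:: p; q]) | p <- iota 1 7, q <- iota 1 7].

Lemma two_formE x y : f x y = comb_form 2 two_form_terms [tuple x; y].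
Proof.
rewrite /comb_form big_allpairs_dep /=.
under eq_bigr do under eq_bigr do rewrite basic_form2E mulrBr.
under eq_bigr do rewrite sumrB.
rewrite sumrB [X in _ - X]exchange_big /= two_form_sum -sumrB.
apply: eq_bigr => p _; rewrite -sumrB; apply: eq_bigr => q _.
rewrite (two_form_anti (evec p) (evec q)); lra.
Qed.

(** The value of F /\ psi on the six basis vectors other than e_k is, up to sign,
    half the contraction of F with phi and e_k. *)
Lemma psi_contraction (al : kform g 2) k :
  (forall x y, al [tuple x; y] = f x y) -> (0 < k <= 7)%N ->
  form_eq0 (wedge al (psi e)) ->
  \sum_(p <- iota 1 7) \sum_(q <- iota 1 7)
     f (evec p) (evec q) * (psi_coef k p q)%:~R = 0.
Proof.
move=> alE hk al0.
have alE' : al =1 comb_form 2 two_form_terms.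
  by move=> w; have [x [y ->]] := tuple2_eta w; rewrite alE two_formE.
have ki : k \in iota 1 7 by rewrite mem_iota.
have sw : size (rem k (iota 1 7)) = 6 by rewrite size_rem.
pose v := [tuple evec (nth 0%N (rem k (iota 1 7)) j) | j < 6].
have := al0 v; rewrite (eq_wedge alE' psiE) wedge_comb_form //.
rewrite /comb_form /wedge_terms big_allpairs_dep big_allpairs_dep.
rewrite /psi_terms => H.
apply: (mulfI (invr_neq0 (_ : 2 != 0 :> R))); first by rewrite pnatr_eq0.
rewrite mulr0 -[RHS]H mulr_sumr big_seq [RHS]big_seq.
apply: eq_bigr => p; rewrite mem_iota => hp.
rewrite mulr_sumr big_seq [RHS]big_seq; apply: eq_bigr => q; rewrite mem_iota => hq.
have frmE t : all (fun i => 0 < i <= 7)%N t -> size t = 4 ->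
    basic_form 6 [:: p, q & t] v = (gdelta [:: p, q & t] (rem k (iota 1 7)))%:~R.
  move=> /allP ht st; rewrite -(gdelta_det _ (n := 6)) //= ?st //.
  congr (\det _); apply/matrixP => i j; rewrite !mxE tnth_mktuple crd_evec //.
    have : nth 0%N [:: p, q & t] i \in [:: p, q & t] by rewrite mem_nth //= st.
    by rewrite !inE => /or3P[/eqP->|/eqP->|/ht].
  have /mem_rem : nth 0%N (rem k (iota 1 7)) j \in rem k (iota 1 7).
    by rewrite mem_nth ?sw.
  by rewrite mem_iota.
have -> : (psi_coef k p q)%:~R = \sum_(x <- psi_signs)
    x.1%:~R * (gdelta [:: p, q & x.2] (rem k (iota 1 7)))%:~R :> R.
  rewrite /psi_coef; elim: psi_signs => [|x r IH]; first by rewrite big_nil.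
  by rewrite big_cons -IH -intrM -intrD.
rewrite big_map mulrA mulr_sumr; apply: eq_big_seq => x xpsi.
have /allP/(_ x xpsi)/andP[hx /eqP sx] :
  all (fun x => all (fun i => 0 < i <= 7)%N x.2 && (size x.2 == 4)) psi_signs by [].
by rewrite -[x.2 in RHS]/(x.2) frmE // mulrA [_^-1 * _]mulrC.
Qed.

Lemma psi_contraction_eqs (al : kform g 2) :
  (forall x y, al [tuple x; y] = f x y) -> form_eq0 (wedge al (psi e)) ->
  let F p q := f (evec p) (evec q) in
  [/\ F 1%N 2%N + F 3%N 4%N + F 5%N 6%N = 0,
      F 6%N 7%N + F 1%N 3%N - F 2%N 4%N = 0,
      F 4%N 7%N - F 1%N 5%N + F 2%N 6%N = 0,
      F 2%N 7%N + F 3%N 5%N - F 4%N 6%N = 0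
    & F 1%N 7%N + F 3%N 6%N + F 4%N 5%N = 0].
Proof.
move=> alE al0 F.
have C k : (0 < k <= 7)%N -> \sum_(u <- psi_support k)
    f (evec u.1) (evec u.2) * (psi_coef k u.1 u.2)%:~R = 0.
  move=> hk; rewrite -[RHS](psi_contraction alE hk al0) big_filter big_mkcond.
  rewrite big_allpairs_dep; apply: eq_bigr => p _; apply: eq_bigr => q _ /=.
  by case: eqP => // ->; rewrite mulr0.
have anti p q : f (evec p) (evec q) = - f (evec q) (evec p) by rewrite two_form_anti.
(* The triples of phi that contain k, without k. *)
have supp7 : psi_support 7 =
  [:: (1, 2); (2, 1); (3, 4); (4, 3); (5, 6); (6, 5)]%N by vm_compute.
have supp5 : psi_support 5 =
  [:: (1, 3); (2, 4); (3, 1); (4, 2); (6, 7); (7, 6)]%N by vm_compute.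
have supp3 : psi_support 3 =
  [:: (1, 5); (2, 6); (4, 7); (5, 1); (6, 2); (7, 4)]%N by vm_compute.
have supp1 : psi_support 1 =
  [:: (2, 7); (3, 5); (4, 6); (5, 3); (6, 4); (7, 2)]%N by vm_compute.
have supp2 : psi_support 2 =
  [:: (1, 7); (3, 6); (4, 5); (5, 4); (6, 3); (7, 1)]%N by vm_compute.
split.
- have := C 7%N isT; rewrite supp7 !big_cons big_nil /=; compute_coefs;
  rewrite !signsE.
  rewrite (anti 2 1)%N (anti 4 3)%N (anti 6 5)%N -!/(F _ _); lra.
- have := C 5%N isT; rewrite supp5 !big_cons big_nil /=; compute_coefs;
  rewrite !signsE.
  rewrite (anti 7 6)%N (anti 3 1)%N (anti 4 2)%N -!/(F _ _); lra.
- have := C 3%N isT; rewrite supp3 !big_cons big_nil /=; compute_coefs;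
  rewrite !signsE.
  rewrite (anti 7 4)%N (anti 5 1)%N (anti 6 2)%N -!/(F _ _); lra.
- have := C 1%N isT; rewrite supp1 !big_cons big_nil /=; compute_coefs;
  rewrite !signsE.
  rewrite (anti 7 2)%N (anti 5 3)%N (anti 6 4)%N -!/(F _ _); lra.
- have := C 2%N isT; rewrite supp2 !big_cons big_nil /=; compute_coefs;
  rewrite !signsE.
  rewrite (anti 7 1)%N (anti 6 3)%N (anti 5 4)%N -!/(F _ _); lra.
Qed.

End TwoForm.

(** * The exterior derivative and the torsion *)

Variables (br : g -> g -> g) (a b c : R).

Definition beta_terms :=
  [:: (a, [:: 1; 2]%N); (b, [:: 3; 4]%N); (c, [:: 5; 6]%N)].
Definition beta x y := comb_form 2 beta_terms [tuple x; y].

Hypothesis br0 : forall i x y, (0 < i < 7)%N -> crd i (br x y) = 0.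
Hypothesis br7 : forall x y, crd 7 (br x y) = - beta x y.

Lemma eq_ce_d k (al al' : kform g k.+1) :
  al =1 al' -> ce_d br al =1 ce_d br al'.
Proof.
by move=> aa v; apply: eq_bigr => i _; apply: eq_bigr => j _; rewrite aa.
Qed.

Lemma ce_d_comb_form k F v :
  ce_d br (comb_form k.+1 F) v = \sum_(x <- F) x.1 * ce_d br (basic_form k.+1 x.2) v.
Proof.
rewrite /ce_d /comb_form.
rewrite [RHS](eq_bigr _ (fun x _ => mulr_sumr _ _ _ _)) exchange_big.
apply: eq_bigr => i _.
rewrite [RHS](eq_bigr _ (fun x _ => mulr_sumr _ _ _ _)) exchange_big.
apply: eq_bigr => j _; rewrite mulr_sumr; apply: eq_bigr => x _.
exact: mulrCA.
Qed.

Lemma ce_d_basic_form0 k s v : all (fun i => 0 < i < 7)%N s -> size s = k.+1 ->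
  ce_d br (basic_form k.+1 s) v = 0.
Proof.
move=> /allP s6 ss; apply: big1 => i _; apply: big1 => j _.
rewrite basic_form_head0 ?mulr0 // => m /s6; exact: br0.
Qed.

(** In al([v_i, v_j], ...) the first argument is - beta(v_i, v_j) e_7, which is
    seen by e^7 only; what remains is the expansion of beta /\ e^t along the two
    rows of beta. *)
Lemma ce_d_basic_form7 k t v : all (fun i => 0 < i < 7)%N t -> size t = k ->
  ce_d br (basic_form k.+1 (7%N :: t)) v = \sum_(P <- beta_terms) P.1 * basic_form k.+2 (P.2 ++ t) v.
Proof.
move=> /allP t6 st.
have szB : all (fun P => size P.2 == 2%N) beta_terms by [].
have two_rows P : size P = 2%N -> basic_form k.+2 (P ++ t) v =
    \sum_(i < k.+2) \sum_(j < k.+1 | (i <= j)%N) (-1) ^+ (i + lift i j) *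
    (- basic_form 2 P [tuple tnth v i; tnth v (lift i j)] *
     basic_form k t [tuple tnth v (lift i (lift j m)) | m < k]).
  by case: P => [|m [|n []]] // _; rewrite [LHS]detform_two_rows;
    apply: eq_bigr => i _; apply: eq_bigr => j _; rewrite basic_form2E.
rewrite big_seq (eq_bigr _ (fun P PB => congr1 (fun r => P.1 * r)
  (two_rows P.2 (eqP (allP szB P PB))))) -big_seq.
rewrite [RHS](eq_bigr _ (fun x _ => mulr_sumr _ _ _ _)) exchange_big.
apply: eq_bigr => i _.
rewrite [RHS](eq_bigr _ (fun x _ => mulr_sumr _ _ _ _)) exchange_big.
apply: eq_bigr => j _.
rewrite basic_form_head //; last first.
  by move=> m /t6; exact: br0.
rewrite br7 /beta /comb_form -sumrN mulr_suml mulr_sumr.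
by apply: eq_bigr => P _; rewrite !mulNr !mulrN; congr (- _); rewrite -mulrA mulrCA.
Qed.

Definition dphi_terms :=
  [:: (a, [:: 1; 2; 3; 4]%N); (b, [:: 3; 4; 1; 2]%N);
      (a, [:: 1; 2; 5; 6]%N); (c, [:: 5; 6; 1; 2]%N);
      (b, [:: 3; 4; 5; 6]%N); (c, [:: 5; 6; 3; 4]%N)].

(** This is beta /\ (e^12 + e^34 + e^56). *)
Lemma ce_d_phi : ce_d br (phi e) =1 comb_form 4 dphi_terms.
Proof.
move=> v; rewrite (eq_ce_d phiE) ce_d_comb_form /phi_terms !big_cons big_nil /=.
rewrite !ce_d_basic_form7 // !ce_d_basic_form0 // /beta_terms /comb_form !big_cons !big_nil /=.
rewrite !(basic_form_eq0 (u := [:: 1; 2; 1; 2]%N)) //.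
rewrite !(basic_form_eq0 (u := [:: 3; 4; 3; 4]%N)) //.
rewrite !(basic_form_eq0 (u := [:: 5; 6; 5; 6]%N)) //.
ring.
Qed.

(** The terms of psi that contain e^7 contain exactly one of the indices in each
    of {1, 2}, {3, 4}, {5, 6}, hence repeat an index once e^7 is replaced by any
    term of beta. *)
Lemma coclosed_psi : coclosed e br.
Proof.
move=> v; rewrite (eq_ce_d psiE) ce_d_comb_form /psi_terms !big_cons big_nil /=.
rewrite !ce_d_basic_form7 // !ce_d_basic_form0 // /beta_terms !big_cons !big_nil /=.
rewrite !basic_form_eq0 //; ring.
Qed.

Lemma wedge_dphi_phi v :
  wedge (ce_d br (phi e)) (phi e) v = 2 * (a + b + c) * vol e v.
Proof.
rewrite (eq_wedge ce_d_phi phiE) wedge_comb_form // comb_form_top // volE.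
rewrite /wedge_terms /= !big_cons big_nil /=.
compute_signs; rewrite !signsE; ring.
Qed.

Lemma wedge_phi_dphi v :
  wedge (phi e) (ce_d br (phi e)) v = 2 * (a + b + c) * vol e v.
Proof.
rewrite (eq_wedge phiE ce_d_phi) wedge_comb_form // comb_form_top // volE.
rewrite /wedge_terms /= !big_cons big_nil /=.
compute_signs; rewrite !signsE; ring.
Qed.

Definition torsion_terms :=
  let s := a + b + c in
  [seq (s / 3 * x.1, x.2) | x <- phi_terms] ++
  [:: (- (b + c), [:: 7; 1; 2]%N); (- (a + c), [:: 7; 3; 4]%N); (- (a + b), [:: 7; 5; 6]%N)].

Lemma star_dphi v : star (p := 4) (q := 3) e (vol e) (ce_d br (phi e)) v =
  comb_form 3 [:: (b + c, [:: 7; 1; 2]%N); (a + c, [:: 7; 3; 4]%N); (a + b, [:: 7; 5; 6]%N)] v.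
Proof.
rewrite (eq_star _ _ ce_d_phi) star_comb_form /comb_form !big_cons !big_nil /=.
pose S s t (hs : size s = 4) (ht : size t = 3) :=
  @star_basic_form 4 3 e (vol e) s t v (basis_free he) coord_crd volE hs ht.
rewrite (S [:: 1; 2; 3; 4]%N [:: 7; 5; 6]%N) //.
rewrite (S [:: 3; 4; 1; 2]%N [:: 7; 5; 6]%N) //.
rewrite (S [:: 1; 2; 5; 6]%N [:: 7; 3; 4]%N) //.
rewrite (S [:: 5; 6; 1; 2]%N [:: 7; 3; 4]%N) //.
rewrite (S [:: 3; 4; 5; 6]%N [:: 7; 1; 2]%N) //.
rewrite (S [:: 5; 6; 3; 4]%N [:: 7; 1; 2]%N) //.
ring.
Qed.

Lemma star_top :
  star (p := 7) (q := 0) e (vol e) (wedge (ce_d br (phi e)) (phi e)) [tuple] =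
  2 * (a + b + c).
Proof.
have vE : wedge (ce_d br (phi e)) (phi e) =1 comb_form 7 [:: (2 * (a + b + c), iota 1 7)].
  by move=> v; rewrite wedge_dphi_phi volE /comb_form big_seq1.
rewrite (eq_star _ _ vE) star_comb_form big_seq1.
rewrite (@star_basic_form 7 0 e (vol e) (iota 1 7) [::] _ (basis_free he) coord_crd volE) //.
by rewrite /basic_form /detform det_mx00 mulr1.
Qed.

Lemma torsionE x y z : torsion e br [tuple x; y; z] =
  comb_form 3 torsion_terms [tuple x; y; z].
Proof.
rewrite /torsion star_top star_dphi phiE /comb_form /torsion_terms /= !big_cons !big_nil /=.
by field; rewrite ?pnatr_eq0.
Qed.

Lemma purely_coclosedE : purely_coclosed e br <-> a + b + c = 0.
Proof.
split=> [[_ /(_ e)]|s0].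
  rewrite wedge_phi_dphi vol_basis; lra.
split; first exact: coclosed_psi.
by move=> v; rewrite wedge_phi_dphi s0 mulr0 mul0r.
Qed.

(** Only the terms e^12 /\ e^3456, e^34 /\ e^1256 and e^56 /\ e^1234 have no
    repeated index, and the three resulting permutations are even.  The scalar k
    is there because the curvature forms to which this applies are the multiples
    beta(u, v) beta of beta. *)
Lemma wedge_beta_psi k v :
  wedge (fun w : 2.-tuple g => k * comb_form 2 beta_terms w) (psi e) v =
  k * (a + b + c) * basic_form 6 (iota 1 6) v.
Proof.
pose F := [:: (k * a, [:: 1; 2]%N); (k * b, [:: 3; 4]%N); (k * c, [:: 5; 6]%N)].
have FE : (fun w : 2.-tuple g => k * comb_form 2 beta_terms w) =1 comb_form 2 F.
  by move=> w; rewrite /comb_form !big_cons !big_nil /=; ring.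
rewrite (eq_wedge FE psiE) wedge_comb_form // /wedge_terms /comb_form /= !big_cons big_nil /=.
rewrite (basic_form_top (n := 6) (u := [:: 3; 4; 1; 2; 5; 6]%N)) //.
rewrite (basic_form_top (n := 6) (u := [:: 5; 6; 1; 2; 3; 4]%N)) //.
rewrite -[[:: 1; 2; 3; 4; 5; 6]%N]/(iota 1 6).
(* e^123456 is hidden so that only the products with a repeated index vanish. *)
set top := basic_form 6 (iota 1 6) v; rewrite !basic_form_eq0 //.
compute_signs; rewrite !signsE; ring.
Qed.

(** * The connection and its curvature *)

Variables (la : R) (D0 D : g -> g -> g).
Hypothesis hlie : is_lie_bracket br.
Hypothesis hD0 : is_levi_civita e br D0.
Hypothesis hD : is_nabla e br D0 la D.

Lemma metricDl x y z : metric e (x + y) z = metric e x z + metric e y z.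
Proof.
by rewrite !metricE -big_split; apply: eq_bigr => i _; rewrite crdD mulrDl.
Qed.

Lemma metricNl x z : metric e (- x) z = - metric e x z.
Proof.
by rewrite !metricE -sumrN; apply: eq_bigr => i _; rewrite crdN mulNr.
Qed.

Lemma metricC x y : metric e x y = metric e y x.
Proof. by rewrite !metricE; apply: eq_bigr => i _; rewrite mulrC. Qed.

Lemma metric_br x y z : metric e (br x y) z = - beta x y * crd 7 z.
Proof.
by rewrite metricE !big_cons big_nil br7 !br0 // !mul0r !add0r addr0.
Qed.

(** Koszul's formula; the derivative terms vanish for left-invariant fields. *)
Lemma koszul x y z : metric e (D0 x y) z =
  (crd 7 x * beta y z - crd 7 y * beta z x - crd 7 z * beta x y) / 2.
Proof.
have tor u v w : metric e (D0 u v) w - metric e (D0 v u) w = - beta u v * crd 7 w.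
  by rewrite -metric_br -(lc_torsion_free hD0) metricDl metricNl.
have met u v w : metric e (D0 u v) w = - metric e (D0 u w) v.
  by have := lc_metric hD0 u v w; rewrite (metricC v); lra.
have := tor x y z; have := tor y z x; have := tor z x y.
have := met x y z; have := met y z x; have := met z x y.
lra.
Qed.

(** With x = a, b, c these are the coefficients of e^712, e^734, e^756 in the
    3-form S = (la T - beta /\ e^7) / 2, and [mu] is the coefficient of
    e^135 - e^146 - e^236 - e^245. *)
Definition block_coef x : R :=
  la / 2 * ((a + b + c) / 3 - (a + b + c - x)) - x / 2.
Definition mu : R := la / 2 * ((a + b + c) / 3).
Notation g1 := (block_coef a).
Notation g2 := (block_coef b).
Notation g3 := (block_coef c).

Definition skew_terms : seq (R * seq nat) :=
  [:: (g1, [:: 7; 1; 2]%N); (g2, [:: 7; 3; 4]%N); (g3, [:: 7; 5; 6]%N);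
      (mu, [:: 1; 3; 5]%N); (- mu, [:: 1; 4; 6]%N); (- mu, [:: 2; 3; 6]%N);
      (- mu, [:: 2; 4; 5]%N)].

(** Koszul's formula and the torsion combine into a 3-form, up to the term
    x_7 beta(y, z): indeed (x_7 beta(y, z) - y_7 beta(z, x) - z_7 beta(x, y)) / 2
    is x_7 beta(y, z) - (beta /\ e^7)(x, y, z) / 2. *)
Lemma nablaE x y z : metric e (D x y) z =
  comb_form 3 skew_terms [tuple x; y; z] + crd 7 x * beta y z.
Proof.
rewrite hD koszul torsionE /torsion_terms /= /beta.
rewrite /comb_form !big_cons !big_nil /= !basic_form3E !basic_form2E.
rewrite /block_coef /mu; by field; rewrite ?pnatr_eq0.
Qed.

Lemma metricZl k x z : metric e (k *: x) z = k * metric e x z.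
Proof.
by rewrite !metricE mulr_sumr; apply: eq_bigr => i _; rewrite crdZ mulrA.
Qed.

Lemma crd_inj x y : (forall i, (0 < i <= 7)%N -> crd i x = crd i y) -> x = y.
Proof.
move=> xy; rewrite (crd_sum x) (crd_sum y).
by apply: eq_big_seq => i; rewrite mem_iota => hi; rewrite xy.
Qed.

Lemma crd_nabla i x y : (0 < i <= 7)%N -> crd i (D x y) =
  comb_form 3 skew_terms [tuple x; y; evec i] + crd 7 x * beta y (evec i).
Proof. by move=> hi; rewrite -metric_evec // nablaE. Qed.

Lemma nabla_linl k x x' y : D (k *: x + x') y = k *: D x y + D x' y.
Proof.
apply: crd_inj => i hi; rewrite crdD crdZ !crd_nabla // /beta /comb_form.
rewrite !big_cons !big_nil /= !basic_form3E !basic_form2E !crdD !crdZ; ring.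
Qed.

Lemma nabla_linr k x y y' : D x (k *: y + y') = k *: D x y + D x y'.
Proof.
apply: crd_inj => i hi; rewrite crdD crdZ !crd_nabla // /beta /comb_form.
rewrite !big_cons !big_nil /= !basic_form3E !basic_form2E !crdD !crdZ; ring.
Qed.

Lemma nabla0l y : D 0 y = 0.
Proof. by have := nabla_linl (-1) 0 0 y; rewrite scaler0 addr0 scaleN1r addNr. Qed.

Lemma nablaZr k x y : D x (k *: y) = k *: D x y.
Proof.
have := nabla_linr k x y 0; rewrite addr0 => ->.
have := nabla_linr (-1) x 0 0.
by rewrite scaler0 addr0 scaleN1r addNr => ->; rewrite addr0.
Qed.

Lemma nablaZl k x y : D (k *: x) y = k *: D x y.
Proof. by have := nabla_linl k x 0 y; rewrite addr0 nabla0l addr0. Qed.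

Lemma curvature_linl u k x x' y :
  curvature br D (k *: x + x') y u = k *: curvature br D x y u + curvature br D x' y u.
Proof.
rewrite /curvature (lie_linearl hlie) !nabla_linl nabla_linr.
apply: crd_inj => i hi; rewrite !(crdD, crdZ, crdN); ring.
Qed.

Lemma curvature_linr u k x y y' :
  curvature br D x (k *: y + y') u = k *: curvature br D x y u + curvature br D x y' u.
Proof.
rewrite /curvature (lie_linearr hlie) !nabla_linl nabla_linr.
apply: crd_inj => i hi; rewrite !(crdD, crdZ, crdN); ring.
Qed.

Lemma curvature_alt u x : curvature br D x x u = 0.
Proof. by rewrite /curvature (lie_alt hlie) nabla0l subrr subr0. Qed.

(** [christoffel p q] is the pair (k, r) with nabla_(e_p) e_q = k e_r: in phi two
    distinct indices determine the third, so there is a single term.  Row p,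
    column q of the table; when the derivative vanishes r is arbitrary. *)
Definition christoffel (p q : nat) : R * nat :=
  let row := nth [::] [::
    [:: (0, 7%N); (g1, 7%N); (mu, 5%N); (- mu, 6%N); (- mu, 3%N); (mu, 4%N); (- g1, 2%N)];
    [:: (- g1, 7%N); (0, 7%N); (- mu, 6%N); (- mu, 5%N); (mu, 4%N); (mu, 3%N); (g1, 1%N)];
    [:: (- mu, 5%N); (mu, 6%N); (0, 7%N); (g2, 7%N); (mu, 1%N); (- mu, 2%N); (- g2, 4%N)];
    [:: (mu, 6%N); (mu, 5%N); (- g2, 7%N); (0, 7%N); (- mu, 2%N); (- mu, 1%N); (g2, 3%N)];
    [:: (mu, 3%N); (- mu, 4%N); (- mu, 1%N); (mu, 2%N); (0, 7%N); (g3, 7%N); (- g3, 6%N)];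
    [:: (- mu, 4%N); (- mu, 3%N); (mu, 2%N); (mu, 1%N); (- g3, 7%N); (0, 7%N); (g3, 5%N)];
    [:: (g1 + a, 2%N); (- (g1 + a), 1%N); (g2 + b, 4%N); (- (g2 + b), 3%N);
        (g3 + c, 6%N); (- (g3 + c), 5%N); (0, 7%N)]] p.-1 in
  nth (0, 7%N) row q.-1.

Lemma christoffel_index p q : (0 < p <= 7)%N -> (0 < q <= 7)%N ->
  (0 < (christoffel p q).2 <= 7)%N.
Proof.
by move: p q => [|[|[|[|[|[|[|[|p]]]]]]]] [|[|[|[|[|[|[|[|q]]]]]]]].
Qed.

Lemma nabla_evec p q : (0 < p <= 7)%N -> (0 < q <= 7)%N ->
  D (evec p) (evec q) = (christoffel p q).1 *: evec (christoffel p q).2.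
Proof.
move=> hp hq; apply: crd_inj => r hr.
rewrite crdZ crd_evec ?christoffel_index // crd_nabla //.
rewrite /beta /comb_form !big_cons !big_nil /=.
rewrite !basic_form3E !basic_form2E !crd_evec //.
move: p q r hp hq hr => [|[|[|[|[|[|[|[|p]]]]]]]] // [|[|[|[|[|[|[|[|q]]]]]]]] //
  [|[|[|[|[|[|[|[|r]]]]]]]] // _ _ _; rewrite /=; ring.
Qed.

Lemma bracket_evec x y : br x y = - beta x y *: evec 7.
Proof.
apply: crd_inj => i hi; rewrite crdZ crd_evec //.
have [->|i7] := eqVneq i 7%N; first by rewrite br7 mulr1.
rewrite mulr0 br0 //; lia.
Qed.

(** Both second derivatives are read off from two successive lookups in the
    table, and the bracket contributes beta(e_p, e_q) nabla_(e_7) e_u. *)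
Lemma curvature_evec p q u v : (0 < p <= 7)%N -> (0 < q <= 7)%N ->
  (0 < u <= 7)%N -> (0 < v <= 7)%N ->
  let C := christoffel in
  metric e (curvature br D (evec p) (evec q) (evec u)) (evec v) =
    (C q u).1 * ((C p (C q u).2).1 * ((C p (C q u).2).2 == v)%:R)
  - (C p u).1 * ((C q (C p u).2).1 * ((C q (C p u).2).2 == v)%:R)
  + beta (evec p) (evec q) * ((C 7 u).1 * ((C 7 u).2 == v)%:R).
Proof.
move=> hp hq hu hv /=; rewrite metric_evec // /curvature bracket_evec.
have idx := christoffel_index.
rewrite !(nabla_evec, nablaZr, nablaZl) ?idx //.
rewrite !(crdD, crdN, crdZ) !crd_evec ?idx //.
by rewrite (eq_sym v) (eq_sym v) (eq_sym v); ring.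
Qed.

(** * Necessity and sufficiency *)

Lemma curvature_formE u v x y :
  curvature_form e br D u v [tuple x; y] = metric e (curvature br D x y u) v.
Proof. by rewrite /curvature_form !(tnth_nth 0). Qed.

Lemma metric0l v : metric e 0 v = 0.
Proof. by have := metricZl 0 0 v; rewrite scale0r mul0r. Qed.

Lemma curvature_metric_linl u v k x x' y :
  metric e (curvature br D (k *: x + x') y u) v =
  k * metric e (curvature br D x y u) v + metric e (curvature br D x' y u) v.
Proof. by rewrite curvature_linl metricDl metricZl. Qed.

Lemma curvature_metric_linr u v k x y y' :
  metric e (curvature br D x (k *: y + y') u) v =
  k * metric e (curvature br D x y u) v + metric e (curvature br D x y' u) v.
Proof. by rewrite curvature_linr metricDl metricZl. Qed.

Lemma curvature_metric_alt u v x : metric e (curvature br D x x u) v = 0.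
Proof. by rewrite curvature_alt metric0l. Qed.

(** Expands a contraction of the curvature at basis vectors into a polynomial in
    a, b, c, la and compares it with the goal. *)
Ltac expand_curvature eq :=
  rewrite /= !curvature_evec // in eq;
  rewrite /beta /comb_form !big_cons !big_nil /= !basic_form2E !crd_evec //= in eq;
  rewrite -[RHS]eq /block_coef /mu; field; rewrite ?pnatr_eq0.

(** The triples (u, v, k) used are (1, 2, 7), (3, 4, 7), (5, 6, 7) for the
    equations U, then (1, 3, 5), (5, 1, 3), (3, 5, 1) for the equations V, and
    (7, 1, 2) for the last equation. *)
Lemma instanton_necessary : G2_instanton e br D -> ~ [/\ a = 0, b = 0 & c = 0] ->
  la = 1 /\ a + b + c = 0.
Proof.
move=> inst abc.
have E u v := psi_contraction_eqs (curvature_metric_linl u v)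
  (curvature_metric_linr u v) (curvature_metric_alt u v)
  (curvature_formE u v) (inst u v).
apply: (instanton_algebra abc).
- split.
  + by have [eq _ _ _ _] := E (evec 1) (evec 2); expand_curvature eq.
  + by have [eq _ _ _ _] := E (evec 3) (evec 4); expand_curvature eq.
  + by have [eq _ _ _ _] := E (evec 5) (evec 6); expand_curvature eq.
- split; apply: oppr_inj; rewrite oppr0.
  + by have [_ eq _ _ _] := E (evec 1) (evec 3); expand_curvature eq.
  + by have [_ _ eq _ _] := E (evec 5) (evec 1); expand_curvature eq.
  + by have [_ _ _ eq _] := E (evec 3) (evec 5); expand_curvature eq.
- by have [_ _ _ _ eq] := E (evec 7) (evec 1); expand_curvature eq.
Qed.

(** For la = 1 and a + b + c = 0 the 3-form S vanishes.  The two second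
    derivatives x_7 y_7 B B u cancel, which leaves
    - nabla_[x, y] u = beta(x, y) B u. *)
Lemma instanton_sufficient : la = 1 -> a + b + c = 0 -> G2_instanton e br D.
Proof.
move=> la1 s0 u v w.
have nabla1 x y z : metric e (D x y) z = crd 7 x * beta y z.
  rewrite nablaE /comb_form !big_cons big_nil /= /block_coef /mu la1 s0.
  have -> : a = - (b + c) by lra.
  by rewrite !(mul0r, mulr0, oppr0, add0r, addr0) ; field; rewrite ?pnatr_eq0.
have curvE x y : metric e (curvature br D x y u) v = beta u v * beta x y.
  rewrite /curvature !metricDl !metricNl !nabla1 br7.
  have crd_D i p q : (0 < i <= 7)%N -> crd i (D p q) = crd 7 p * beta q (evec i).
    by move=> hi; rewrite -nabla1 metric_evec.
  rewrite /beta /comb_form !big_cons !big_nil /= !basic_form2E !crd_D // /beta /comb_form.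
  rewrite !big_cons !big_nil /= !basic_form2E !crd_evec //=; ring.
have FE : curvature_form e br D u v =1
    (fun w => beta u v * comb_form 2 beta_terms w).
  by move=> t; have [x [y ->]] := tuple2_eta t; rewrite curvature_formE curvE.
by rewrite (eq_wedge FE (frefl _)) wedge_beta_psi // s0 mulr0 mul0r.
Qed.

End LeftInvariantForms.

Theorem theorem3p3 (R : realType) (g : vectType R) (br : g -> g -> g)
  (e : 7.-tuple g) (a b c la : R) (D0 D : g -> g -> g)
  (hdim : \dim {:g} = 7%N)
  (hlie : is_lie_bracket br)
  (hnil : two_step_nilpotent br)
  (he : basis_of fullv e)
  (hde : forall i : nat, (1 <= i <= 6)%N -> form_eq0 (ce_d br (dual e i)))
  (hde7 : forall v : 2.-tuple g,
     ce_d br (dual e 7) v = a * ext e [:: 1; 2]%N v + b * ext e [:: 3; 4]%N v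
                            + c * ext e [:: 5; 6]%N v)
  (habc : ~ [/\ a = 0, b = 0 & c = 0])
  (hD0 : is_levi_civita e br D0)
  (hD : is_nabla e br D0 la D) :
  G2_instanton e br D <-> la = 1 /\ purely_coclosed e br.
Proof.
have br0 i x y : (0 < i < 7)%N -> crd e i (br x y) = 0.
  move=> hi; have := hde i; rewrite hi => /(_ isT [tuple x; y]).
  by rewrite ce_d_dual => /eqP; rewrite oppr_eq0 => /eqP.
have br7 x y : crd e 7 (br x y) = - beta e a b c x y.
  have := hde7 [tuple x; y]; rewrite ce_d_dual !ext_basic_form => /eqP.
  rewrite eqr_oppLR => /eqP ->; congr (- _).
  by rewrite /beta /comb_form !big_cons big_nil /= addr0 addrA.
rewrite (purely_coclosedE he br0 br7); split=> [inst|[la1 s0]].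
  exact: (instanton_necessary he br0 br7 hlie hD0 hD inst habc).
exact: (instanton_sufficient he br0 br7 hD0 hD).
Qed.
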